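(* Let $\hat S_3^n$ denote the Sierpiński triangle graph with extreme vertices $\hat 0,\hat 1,\hat 2$. Then: (i) for any $n\ge 0$, each minimum feedback vertex set of $\hat S_3^n$ contains at most one vertex in $\{\hat 0,\hat 1,\hat 2\}$; (ii) for any $n\ge 0$, $\hat S_3^n$ has a minimum feedback vertex set $A_n$ such that $|A_n\cap\{\hat 0,\hat 1,\hat 2\}|=1$; (iii) for any $n\ge 1$, $\tau(\hat S_3^n)=3\,\tau(\hat S_3^{n-1})-1$; (iv) for any $n\ge 0$, $\tau(\hat S_3^n)=\dfrac{3^n+1}{2}=\dfrac{|V(\hat S_3^n)|}{3}$.
   Context: All graphs are simple, finite and undirected. For a graph $G$, a set $X\subseteq V(G)$ is a feedback vertex set of $G$ if $G-X$ is a forest; the feedback vertex number $\tau(G)$ is the minimum cardinality of a feedback vertex set of $G$, and a minimum feedback vertex set is one of cardinality $\tau(G)$. For an integer $p\ge 1$ let $P=\{0,1,\ldots,p-1\}$, let $[n]=\{1,\ldots,n\}$, and let $P^n$ be the set of all $n$-tuples over $P$, written as words of length $n$ ($P^0$ consists of the empty word only); $j^{m}$ denotes the word consisting of $m$ copies of $j$. For integers $p\ge 1$, $n\ge 0$, the Sierpiński graph $S_p^n$ is given by $V(S_p^n)=P^n$ and $$E(S_p^n)=\{\{\underline{s}ij^{d-1},\underline{s}ji^{d-1}\} \mid i,j\in P,\ i\ne j,\ d\in[n],\ \underline{s}\in P^{n-d}\}.$$ For integers $p\ge 1$, $n\ge 0$, the generalized Sierpiński triangle graph $\hat S_p^n$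 is obtained from $S_p^{n+1}$ by contracting all non-clique edges, i.e. all edges of the form $\{\underline{s}ij^{l},\underline{s}ji^{l}\}$ with distinct $i,j\in P$, $l\in[n]$, $\underline{s}\in P^{n-l}$. The extreme vertices $k^{n+1}$ ($k\in P$) of $S_p^{n+1}$ are not incident with any non-clique edge; the vertex of $\hat S_p^n$ corresponding to $k^{n+1}$ is denoted $\hat k$. In particular $\hat S_p^0\cong K_p$ with vertex set $\{\hat k\mid k\in P\}$. The Sierpiński triangle graph $\hat S_3^n$ is the case $p=3$. *)

(* Defs.v *)
From mathcomp Require Import all_boot.

Set Implicit Arguments.
Unset Strict Implicit.
Unset Printing Implicit Defensive.

Record sgraph := SGraph {
  vertex :> finType;
  adj : rel vertex;
  adj_sym : symmetric adj;
  adj_irrefl : irreflexive adj }.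

(* The bound on the length of the cycle only serves decidability: see forestP. *)
Definition forest (G : sgraph) : bool :=
  [forall k : 'I_#|G|.+1, forall c : k.-tuple G,
     (2 < k) ==> ~~ ucycleb (@adj G) c].

Lemma forestP (G : sgraph) :
  reflect (forall c : seq G, 2 < size c -> ~ ucycle (@adj G) c) (forest G).
Proof.
apply: (iffP forallP) => [fG c c_gt2 c_cycle | fG k].
  have /card_uniqP c_card : uniq c by case/andP: c_cycle.
  have c_le : size c < #|G|.+1 by rewrite ltnS -c_card max_card.
  have /forallP/(_ (in_tuple c))/implyP/(_ c_gt2)/negP := fG (Ordinal c_le).
  by apply.
apply/forallP => c; apply/implyP => k_gt2.
by apply/negP; apply: fG; rewrite size_tuple.
Qed.

Section Deletion.
Variables (G : sgraph) (X : {set G}).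

Definition del_adj : rel {x : G | x \notin X} :=
  [rel x y | adj (val x) (val y)].

Lemma del_adj_sym : symmetric del_adj.
Proof. by move=> x y; apply: adj_sym. Qed.

Lemma del_adj_irrefl : irreflexive del_adj.
Proof. by move=> x; apply: adj_irrefl. Qed.

Definition delete_vertices : sgraph := SGraph del_adj_sym del_adj_irrefl.
End Deletion.

Definition feedback_vertex_set (G : sgraph) (X : {set G}) : bool :=
  forest (delete_vertices X).

Lemma feedback_vertex_setT (G : sgraph) : feedback_vertex_set [set: G].
Proof. by apply/forestP => -[//|x c]; have := valP x; rewrite in_setT. Qed.

Definition feedback_vertex_number (G : sgraph) : nat :=
  #|[arg min_(X < [set: G] | feedback_vertex_set X) #|X| ]|.

Lemma feedback_vertex_numberP (G : sgraph) :
  (exists2 X : {set G}, feedback_vertex_set X & #|X| = feedback_vertex_number G)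
  /\ forall X : {set G}, feedback_vertex_set X -> feedback_vertex_number G <= #|X|.
Proof.
rewrite /feedback_vertex_number.
case: arg_minnP => [|X fX minX]; first exact: feedback_vertex_setT.
by split=> //; exists X.
Qed.

Definition minimum_fvs (G : sgraph) (X : {set G}) : bool :=
  feedback_vertex_set X && (#|X| == feedback_vertex_number G).

(* Contraction of all the edges in c, where c is a symmetric subrelation of    *)
(* adj: the vertices are the connected components of c; loops and parallel     *)
(* edges are discarded, so the result is again simple.                         *)
Section Contraction.
Variables (G : sgraph) (c : rel G).

Definition contract_vertex : finType :=
  {A : {set G} | A \in equivalence_partition (connect c) [set: G]}.

Definition contract_class (x : G) : contract_vertex :=
  exist _ [set y in [set: G] | connect c x y] (imset_f _ (in_setT x)).

Definition contract_adj : rel contract_vertex :=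
  [rel A B : contract_vertex | (A != B) && [exists x in val A, exists y in val B, adj x y]].

Lemma contract_adj_sym : symmetric contract_adj.
Proof.
move=> A B; rewrite /contract_adj /= eq_sym; congr (_ && _).
by apply/exists_inP/exists_inP => -[x xA /exists_inP[y yB xy]];
  exists y => //; apply/exists_inP; exists x; rewrite // adj_sym.
Qed.

Lemma contract_adj_irrefl : irreflexive contract_adj.
Proof. by move=> A; rewrite /contract_adj /= eqxx. Qed.

Definition contract : sgraph := SGraph contract_adj_sym contract_adj_irrefl.
End Contraction.

(* The pairs s i j^l, s j i^l with i <> j; the letter d of the usual            *)
(* definition of the Sierpinski graphs is l + 1.                               *)
Definition sierpinski_link (p n l : nat) : rel (n.-tuple 'I_p) :=
  [rel u v : n.-tuple 'I_p | [exists i : 'I_p, exists j : 'I_p,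
     exists s : (n - l.+1).-tuple 'I_p,
       [&& i != j,
           u == s ++ i :: nseq l j :> seq 'I_p &
           v == s ++ j :: nseq l i :> seq 'I_p]]].

Lemma sierpinski_link_sym p n l : symmetric (@sierpinski_link p n l).
Proof.
by move=> u v; apply/existsP/existsP => -[i /existsP[j /existsP[s /and3P[ij us vs]]]];
  exists j; apply/existsP; exists i; apply/existsP; exists s;
  rewrite eq_sym ij us vs.
Qed.

Lemma sierpinski_link_irrefl p n l : irreflexive (@sierpinski_link p n l).
Proof.
move=> u; apply/existsP => -[i /existsP[j /existsP[s /and3P[ij /eqP-> /eqP]]]].
by move/eqP; rewrite eqseq_cat // eqxx /= eqseq_cons (negPf ij).
Qed.

Definition sierpinski_adj (p n : nat) : rel (n.-tuple 'I_p) :=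
  [rel u v : n.-tuple 'I_p | [exists l : 'I_n, sierpinski_link l u v]].

Lemma sierpinski_adj_sym p n : symmetric (@sierpinski_adj p n).
Proof. by move=> u v; apply: eq_existsb => l; apply: sierpinski_link_sym. Qed.

Lemma sierpinski_adj_irrefl p n : irreflexive (@sierpinski_adj p n).
Proof. by move=> u; apply/existsP => -[l]; rewrite sierpinski_link_irrefl. Qed.

Definition sierpinski (p n : nat) : sgraph :=
  SGraph (@sierpinski_adj_sym p n) (@sierpinski_adj_irrefl p n).

Definition nonclique (p n : nat) : rel (sierpinski p n) :=
  [rel u v : n.-tuple 'I_p | [exists l : 'I_n, (0 < l) && sierpinski_link l u v]].

Lemma nonclique_sym p n : symmetric (@nonclique p n).
Proof.
by move=> u v; apply: eq_existsb => l; rewrite sierpinski_link_sym.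
Qed.

Lemma nonclique_sub p n : subrel (@nonclique p n) (@adj (sierpinski p n)).
Proof. by move=> u v /existsP[l /andP[_ uv]]; apply/existsP; exists l. Qed.

Definition sierpinski_triangle (p n : nat) : sgraph :=
  contract (@nonclique p n.+1).

Definition hat (p n : nat) (k : 'I_p) : sierpinski_triangle p n :=
  contract_class (@nonclique p n.+1) (nseq_tuple n.+1 k).

Definition extreme_vertices (p n : nat) : {set sierpinski_triangle p n} :=
  [set hat n k | k : 'I_p].

Lemma nonclique_extreme p n (k : 'I_p) (v : sierpinski p n.+1) :
  nonclique (nseq_tuple n.+1 k) v = false.
Proof.
apply/existsP => -[l /andP[l_gt0 /existsP[i /existsP[j /existsP[s]]]]].
case/and3P=> ij /eqP us _; move: ij.
have all_k w : w \in s ++ i :: nseq l j -> w = k.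
  by rewrite -us mem_nseq => /andP[_ /eqP].
have -> : i = k by apply: all_k; rewrite mem_cat mem_head orbT.
have -> : j = k.
  by apply: all_k; rewrite mem_cat in_cons mem_nseq l_gt0 eqxx !orbT.
by rewrite eqxx.
Qed.

Lemma hat_inj p n : injective (@hat p n).
Proof.
move=> k k' /(congr1 val)/setP/(_ (nseq_tuple n.+1 k')).
rewrite !in_set connect0 => /connectP[[|v r]].
  by move=> _ /(congr1 val)[].
by rewrite /= nonclique_extreme.
Qed.

(* Main.v *)
Require Import Defs.
From mathcomp Require Import all_boot all_order all_algebra.
From mathcomp Require Import zify.

Set Implicit Arguments.
Unset Strict Implicit.
Unset Printing Implicit Defensive.
Import Order.TTheory GRing.Theory Num.Theory.

(** The vertices of the graph are read as classes of words: a word w of length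
n+1 over P is a corner of the elementary clique indexed by its first n letters,
and contraction glues the corner s i j^l to the corner s j i^l, for i <> j and
l >= 1.

Lower bound. Every vertex is a corner of exactly two elementary cliques, except
the extreme vertices, which are corners of one; hence, for any set B of
vertices, the number of words in a class of B is 2|B| - |B :&: extremes|
([card_preim_proj]). For p = 3 the elementary cliques are 3^n triangles, and a
feedback vertex set B has a corner in each of them, so
3^n + |B :&: extremes| <= 2|B| ([fvs_lower_bound]). As 3^n is odd, this forces
2|B| >= 3^n + 1, and a set with 2|B| = 3^n + 1 has at most one extreme vertex.

Upper bound. The graph has a proper 3-colouring ([color]), each of whose classes
meets each triangle exactly once and contains exactly one extreme vertex, so
that the count above gives each class X the size 2|X| = 3^n + 1. Deleting the
class of colour k leaves one edge in each triangle, and these 3^n edges form a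
path: the Sierpinski arrowhead curve, which goes from one of the other two
extreme vertices to the other. Numbering the vertices along this curve
([stop]) shows that there is no cycle ([color_class_fvs]). So every colour class
is a minimum feedback vertex set, and the three classes partition the vertices,
which gives the number of vertices as well. *)

(** * Acyclicity from a ranking of the vertices *)

(** On a cycle, a vertex of least rank would have its two distinct neighbours
ranked at least as high as itself. *)
Lemma forest_of_rank (G : sgraph) (r : G -> nat) :
  (forall x y z : G, adj x y -> adj x z ->
     r x <= r y -> r x <= r z -> y = z) ->
  forest G.
Proof.
move=> r_up; apply/forestP => -[//|x0 c'] c_gt2 /andP[c_cyc c_uniq].
set c := x0 :: c' in c_gt2 c_cyc c_uniq *.
have x0c : x0 \in c by rewrite mem_head.
case: (arg_minnP r x0c) => x xc x_min.
have [i c1 rot_c] := rot_to xc.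
have c_sub w : w \in rot i c -> r x <= r w by rewrite mem_rot; apply: x_min.
move: c_gt2 c_cyc c_uniq c_sub.
rewrite -(size_rot i) -(rot_cycle i) -(rot_uniq i) rot_c.
case: c1 {rot_c} => [|y [|z c1]] // _ c_cyc c_uniq c_sub.
have xy : adj x y by case/andP: c_cyc.
have xl : adj x (last z c1).
  by move: c_cyc; rewrite /= rcons_path => /and4P[_ _ _]; rewrite adj_sym.
have y_last : y = last z c1.
  apply: (r_up x) => //; apply: c_sub; first by rewrite !in_cons eqxx orbT.
  by rewrite 2!in_cons mem_last !orbT.
by case/and3P: c_uniq => _ /negP[]; rewrite y_last mem_last.
Qed.

(** * The word glued to a given word *)

Section Mate.
Variable T : eqType.
Implicit Types (s w : seq T) (i j : T).

(** The largest constant suffix j^l of a non-constant word is preceded by some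
letter i distinct from j; [mate] exchanges i and j in this suffix i j^l. *)
Fixpoint mate (w : seq T) : seq T :=
  if w is x :: w' then
    if w' is y :: _ then
      if constant w' then y :: nseq (size w') x else x :: mate w'
    else w
  else w.

Lemma size_mate w : size (mate w) = size w.
Proof.
elim: w => [//|x [|y w] /= IH] //.
by case: ifP => _ /=; rewrite ?size_nseq ?IH.
Qed.

Lemma constant_cat_nseq s i j l :
  constant (s ++ i :: nseq l.+1 j :> seq T) -> i = j.
Proof.
case: s => [|x s] /=; first by case/andP=> /eqP.
by rewrite all_cat /= => /and4P[_ /eqP-> /eqP->].
Qed.

Lemma mate_switch s i j l : i != j ->
  mate (s ++ i :: nseq l.+1 j) = s ++ j :: nseq l.+1 i.
Proof.
move=> ij; elim: s => [|x s IH].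
  by have /= -> := constant_nseq l.+1 j; rewrite size_nseq.
have not_const : ~~ constant (s ++ i :: nseq l.+1 j).
  by apply: contra ij => /constant_cat_nseq ->.
by rewrite !cat_cons /= (negPf not_const) IH; case: (s).
Qed.

(** This case analysis replaces recursion on words in the study of [mate]. *)
Lemma constant_or_switch w :
  constant w \/ exists s i j l, i != j /\ w = s ++ i :: nseq l.+1 j.
Proof.
elim: w => [|x w [w_const | [s [i [j [l [ij ->]]]]]]]; first by left.
- case: w w_const => [|y w]; first by left.
  have [<- | xy] := eqVneq x y => /= w_const; first by left; rewrite /= eqxx.
  right; exists [::], x, y, (size w); split=> //=.
  by rewrite [in LHS](all_pred1P _ _ w_const).
- by right; exists (x :: s), i, j, l.
Qed.

Lemma mate_constant w : constant w -> mate w = w.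
Proof.
case: w => [|x [|y w]] //= /andP[/eqP <- w_const].
by rewrite w_const -(all_pred1P _ _ w_const).
Qed.

Lemma mateK : involutive mate.
Proof.
move=> w; have [w_const | [s [i [j [l [ij ->]]]]]] := constant_or_switch w.
  by rewrite !mate_constant.
by rewrite !mate_switch // eq_sym.
Qed.

Lemma mate_eq w : (mate w == w) = constant w.
Proof.
apply/eqP/idP=> [|/mate_constant //].
have [// | [s [i [j [l [ij ->]]]]]] := constant_or_switch w.
rewrite mate_switch // => /eqP; rewrite eqseq_cat // eqxx /= eqseq_cons.
by rewrite eq_sym (negPf ij).
Qed.

End Mate.

(** * Words, elementary cliques and vertices *)

Section Fibres.
Variables p n : nat.
Local Notation word := (sierpinski p n.+1).
Implicit Types (u v w : word) (B : {set sierpinski_triangle p n}).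

Definition mate_word w : word :=
  Tuple (introT eqP (etrans (size_mate w) (size_tuple w))).

Lemma mate_wordK : involutive mate_word.
Proof. by move=> w; apply/val_inj/mateK. Qed.

Lemma nonclique_mate u v : nonclique u v = (v == mate_word u) && (u != v).
Proof.
apply/existsP/andP => [[l /andP[l_gt0 /existsP[i /existsP[j /existsP[s]]]]]|].
  case/and3P=> ij /eqP us /eqP vs.
  case: l => -[//|l] lP in l_gt0 s us vs *.
  rewrite -!(inj_eq val_inj) /= us vs mate_switch //; split=> //.
  by rewrite eqseq_cat // eqxx /= eqseq_cons (negPf ij).
case=> /eqP-> mate_neq.
have [u_const | [s [i [j [l [ij us]]]]]] := constant_or_switch u.
  by case/eqP: mate_neq; apply/val_inj; rewrite /= mate_constant.
have size_s : (size s + l.+2 = n.+1).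
  by rewrite -(size_tuple u) us size_cat /= size_nseq.
have l_lt : (l.+1 < n.+1) by lia.
exists (Ordinal l_lt) => /=; apply/existsP; exists i; apply/existsP; exists j.
have size_sP : size s == (n.+1 - l.+2) by apply/eqP; lia.
by apply/existsP; exists (Tuple size_sP); rewrite ij /= us mate_switch // !eqxx.
Qed.

(** A word is incident with at most one non-clique edge, so contraction merges
words at most in pairs. *)
Lemma connect_nonclique u v :
  connect (@nonclique p n.+1) u v = (v == u) || (v == mate_word u).
Proof.
apply/idP/idP => [/connectP[q uq ->]|/orP[/eqP-> | /eqP->]]; last 2 first.
- exact: connect0.
- have [<- | neq] := eqVneq u (mate_word u); first exact: connect0.
  by apply: connect1; rewrite nonclique_mate eqxx.
suff orbit q' x : path (@nonclique p n.+1) x q' ->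
    (x == u) || (x == mate_word u) ->
    (last x q' == u) || (last x q' == mate_word u).
  by apply: orbit uq _; rewrite eqxx.
elim: q' x => [|y q' IH] x //= /andP[xy yq] xu; apply: (IH y yq).
move: xy; rewrite nonclique_mate => /andP[/eqP-> _].
by case/orP: xu => /eqP->; rewrite ?mate_wordK eqxx ?orbT.
Qed.

Local Notation proj := (contract_class (@nonclique p n.+1)).

Lemma mem_contract_class u v :
  (v \in val (proj u)) = (v == u) || (v == mate_word u).
Proof. by rewrite !inE connect_nonclique. Qed.

Lemma contract_class_eq u v :
  (proj u == proj v) = (v == u) || (v == mate_word u).
Proof.
apply/eqP/idP => [uv | /orP[/eqP-> // | /eqP->]].
  by rewrite -mem_contract_class uv mem_contract_class eqxx.
apply/val_inj/setP => w; rewrite !mem_contract_class mate_wordK.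
exact: orbC.
Qed.

Lemma contract_class_onto (x : sierpinski_triangle p n) : exists u, x = proj u.
Proof. by case/imsetP: (valP x) => u _ xu; exists u; apply: val_inj. Qed.

Lemma extreme_constant u : (proj u \in extreme_vertices p n) = constant u.
Proof.
apply/imsetP/idP => [[k _ /eqP] | u_const].
  have k_const : constant (nseq n.+1 k) by apply: constant_nseq.
  rewrite eq_sym contract_class_eq => /orP[] /eqP-> //.
  by change (is_true (constant (mate (nseq n.+1 k)))); rewrite mate_constant.
case: u u_const => -[|k u] // u_size u_const.
exists k => //; congr proj; apply: val_inj => /=.
move/eqP: (u_size) => [<-]; congr (_ :: _).
exact/all_pred1P.
Qed.

(** Double counting of the incidences between vertices and elementary cliques: a
vertex is represented by two words, [u] and [mate u], unless it is extreme, in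
which case these coincide. *)
Lemma card_preim_proj B :
  (#|[set w | proj w \in B]| + #|B :&: extreme_vertices p n| = #|B|.*2).
Proof.
have -> : (#|[set w | proj w \in B]| =
           \sum_(x in B) #|[set w | proj w == x]|).
  rewrite -sum1_card (partition_big proj [in B]) => [|w]; last by rewrite inE.
  apply: eq_bigr => x xB; rewrite -sum1_card; apply: eq_bigl => w.
  by rewrite !inE andb_idl // => /eqP->.
have -> : (#|B :&: extreme_vertices p n| =
           \sum_(x in B) (x \in extreme_vertices p n)).
  rewrite -sum1_card big_mkcond [RHS]big_mkcond; apply: eq_bigr => x _.
  by rewrite in_setI; case: (x \in B); case: (x \in _).
rewrite -big_split -muln2 -sum_nat_const; apply: eq_bigr => x _ /=.
have [u ->] := contract_class_onto x; rewrite extreme_constant -mate_eq.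
have -> : [set w | proj w == proj u] = [set u; mate_word u].
  by apply/setP => w; rewrite !inE eq_sym contract_class_eq.
by rewrite cards2 -(inj_eq val_inj) /= eq_sym; case: eqP.
Qed.

(** No elementary clique is collapsed by the contraction: the exchange made by
[mate] also changes a letter other than the last one. *)
Lemma clique_injective (s : n.-tuple 'I_p) (i j : 'I_p) :
  proj (rcons_tuple s i) = proj (rcons_tuple s j) -> i = j.
Proof.
move/eqP; rewrite contract_class_eq -!(inj_eq val_inj) /=.
case/orP=> /eqP; first by case/rcons_inj.
have [w_const | [t [i' [j' [l [ij def_w]]]]]] := constant_or_switch (rcons s i).
  by rewrite mate_constant // => /rcons_inj[].
rewrite def_w mate_switch // => def_w'; move: def_w def_w'.
rewrite -[in X in X -> _]addn1 -[in X in _ -> X -> _]addn1.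
rewrite !nseqD !cats1 -!rcons_cons -!rcons_cat.
case/rcons_inj=> -> _ /rcons_inj[/eqP].
by rewrite eqseq_cat // eqxx /= eqseq_cons (negPf ij).
Qed.

Lemma adj_sierpinski_triangle (x y : sierpinski_triangle p n) :
  adj x y <-> exists (s : n.-tuple 'I_p) (i j : 'I_p),
    [/\ i != j, x = proj (rcons_tuple s i) & y = proj (rcons_tuple s j)].
Proof.
split=> [|[s [i [j [ij -> ->]]]]].
  case/andP=> xy /exists_inP[u xu /exists_inP[v yv /existsP[l uv]]].
  have [x' def_x] := contract_class_onto x.
  have [y' def_y] := contract_class_onto y.
  have {x' def_x xu}def_x : x = proj u.
    by apply/eqP; rewrite def_x contract_class_eq -mem_contract_class -def_x.
  have {y' def_y yv}def_y : y = proj v.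
    by apply/eqP; rewrite def_y contract_class_eq -mem_contract_class -def_y.
  have [l_gt0 | ] := posnP l; last first.
    move=> l_gt0; case/eqP: xy; rewrite def_x def_y; apply/eqP.
    rewrite contract_class_eq orbC; apply/orP; left.
    have : nonclique u v by apply/existsP; exists l; rewrite l_gt0.
    by rewrite nonclique_mate => /andP[].
  move: uv; rewrite l_gt0.
  case/existsP=> i /existsP[j /existsP[s /and3P[ij /eqP us /eqP vs]]].
  have size_s : size s == n by rewrite size_tuple subn1.
  exists (Tuple size_s), i, j; split=> //.
    by rewrite def_x; congr proj; apply: val_inj; rewrite /= -cats1; exact: us.
  by rewrite def_y; congr proj; apply: val_inj; rewrite /= -cats1; exact: vs.
apply/andP; split; first by apply: contra ij => /eqP/clique_injective->.
apply/exists_inP; exists (rcons_tuple s i).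
  by rewrite mem_contract_class eqxx.
apply/exists_inP; exists (rcons_tuple s j).
  by rewrite mem_contract_class eqxx.
apply/existsP; exists ord0; apply/existsP; exists i; apply/existsP; exists j.
have size_s : size s == (n.+1 - 1) by rewrite size_tuple subn1.
by apply/existsP; exists (Tuple size_s); rewrite ij /= !cats1 !eqxx.
Qed.

Lemma card_word_set (W : pred word) :
  #|[set w | W w]| =
    \sum_(s : n.-tuple 'I_p) #|[set i | W (rcons_tuple s i)]|.
Proof.
pose snoc (q : n.-tuple 'I_p * 'I_p) : word := rcons_tuple q.1 q.2.
have snoc_bij : bijective snoc.
  apply: inj_card_bij.
    by move=> [s i] [t j] /(congr1 val)/rcons_inj[/val_inj<- <-].
  by rewrite card_prod !card_tuple card_ord expnSr.
rewrite -sum1dep_card (reindex snoc) /=; last exact: onW_bij.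
rewrite -(pair_big_dep xpredT (fun s i => W (snoc (s, i))) (fun _ _ => 1)) /=.
by apply: eq_bigr => s _; rewrite sum1dep_card.
Qed.

End Fibres.

(** * The 3-colouring *)

(** For i <> j this is the third element of P, and [third i i = i]: the form
- (i + j) in Z/3 covers both cases and makes the algebra uniform. *)
Definition third (i j : 'I_3) : 'I_3 := (- (i + j))%R.

Lemma thirdC i j : third i j = third j i.
Proof. by rewrite /third addrC. Qed.

Lemma third_id i : third i i = i.
Proof. by apply/eqP; case: i => -[|[|[|]]]. Qed.

Lemma thirdK i : involutive (third i).
Proof. by move=> j; rewrite /third opprD opprK addKr. Qed.

(** The common prefix of the corners of a triangle acts on their last letters as
a permutation, whence a proper colouring. *)
Lemma foldr_third_bij s : bijective (foldr third ^~ s).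
Proof.
elim: s => [|x s [f fK Kf]] /=; first by exists id.
exists (f \o third x) => y /=; first by rewrite thirdK fK.
by rewrite Kf thirdK.
Qed.

Implicit Types (i j k : 'I_3) (d : 'I_3 * 'I_3) (s t w : seq 'I_3).

(** The colouring of level n+1 consists of the colourings of the three copies of
level n, where copy x has the two colours other than x exchanged: this
exchange is [third x], and it makes the copies agree at their common vertices.
Starting the fold at the last letter makes that letter its own colour, since
[third x x = x]. *)
Definition color (w : seq 'I_3) : 'I_3 := foldr third (last ord0 w) w.

Lemma color_rcons s x : color (rcons s x) = foldr third x s.
Proof. by rewrite /color last_rcons foldr_rcons third_id. Qed.

Lemma color_constant k n : color (nseq n.+1 k) = k.
Proof.
have -> : nseq n.+1 k = rcons (nseq n k) k.
  by rewrite -cats1 -[n.+1]addn1 nseqD.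
by rewrite color_rcons; elim: n => //= n ->; rewrite third_id.
Qed.

Lemma color_cons x w : 0 < size w -> color (x :: w) = third x (color w).
Proof. by case: w. Qed.

Lemma color_cat s w : 0 < size w -> color (s ++ w) = foldr third (color w) s.
Proof.
move=> w_gt0; elim: s => //= x s IH.
by rewrite color_cons ?IH // size_cat addn_gt0 w_gt0 orbT.
Qed.

Lemma color_switch i j l : color (i :: nseq l.+1 j) = third i j.
Proof. by rewrite color_cons // color_constant. Qed.

(** So [color] is defined on vertices: the two words s i j^l and s j i^l get
their colour from [third i j], which is symmetric. *)
Lemma color_mate w : color (mate w) = color w.
Proof.
have [w_const | [s [i [j [l [ij ->]]]]]] := constant_or_switch w.
  by rewrite mate_constant.
by rewrite mate_switch // !color_cat // !color_switch thirdC.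
Qed.

(** * The arrowhead curve *)

(** A pair d = (a, b) with a <> b stands for the curve from the extreme vertex a
to the extreme vertex b, which avoids the vertices coloured by the third letter
c. It runs through copy a from a to c, then through copy c from a to b, then
through copy b from c to b: [turn d x] is the direction in which copy x is
traversed, and [leg d x] is the rank of copy x in this order. *)
Definition turn (d : 'I_3 * 'I_3) (x : 'I_3) : 'I_3 * 'I_3 :=
  (if x == d.2 then third d.1 d.2 else d.1,
   if x == d.1 then third d.1 d.2 else d.2).

Definition leg (d : 'I_3 * 'I_3) (x : 'I_3) : nat := (x != d.1) + (x == d.2).

(** The position of an elementary triangle on the curve, which visits each of
them once. On a word that names a vertex, with one letter more, it is the
position of a corner. *)
Fixpoint arrow (d : 'I_3 * 'I_3) (w : seq 'I_3) : nat :=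
  if w is x :: w' then leg d x * 3 ^ size w' + arrow (turn d x) w' else 0.

Lemma turn_neq d x : d.1 != d.2 -> (turn d x).1 != (turn d x).2.
Proof. by case: d x => [] [[|[|[|i]]] ?] [[|[|[|j]]] ?] [[|[|[|x]]] ?]. Qed.

Lemma third_turn d x : d.1 != d.2 ->
  third (turn d x).1 (turn d x).2 = third x (third d.1 d.2).
Proof.
move=> d_neq; apply/eqP.
by case: d x d_neq => [] [[|[|[|i]]] ?] [[|[|[|j]]] ?] [[|[|[|x]]] ?].
Qed.

Lemma leg_lt3 d x : leg d x < 3.
Proof. by rewrite /leg; case: eqP; case: eqP. Qed.

Lemma leg_inj d : d.1 != d.2 -> injective (leg d).
Proof.
move=> d_neq x y /eqP; apply: contraTeq.
by case: d x y d_neq =>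
  [] [[|[|[|i]]] ?] [[|[|[|j]]] ?] [[|[|[|x]]] ?] [[|[|[|y]]] ?].
Qed.

Lemma leg_third d x : d.1 != d.2 -> (leg d x == 1) = (x == third d.1 d.2).
Proof. by case: d x => [] [[|[|[|i]]] ?] [[|[|[|j]]] ?] [[|[|[|x]]] ?]. Qed.

Lemma arrow_lt d w : arrow d w < 3 ^ size w.
Proof.
elim: w d => //= x w IH d; have := IH (turn d x); have := leg_lt3 d x.
rewrite expnS; nia.
Qed.

Lemma arrow_inj d s t : d.1 != d.2 -> size s = size t ->
  arrow d s = arrow d t -> s = t.
Proof.
elim: s t d => [|x s IH] [|y t] d //= d_neq [st]; rewrite st => arrow_eq.
have ltx := arrow_lt (turn d x) s; have lty := arrow_lt (turn d y) t.
rewrite st in ltx.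
have legs : leg d x = leg d y.
  have := congr1 (divn^~ (3 ^ size t)) arrow_eq.
  by rewrite !divnMDl ?expn_gt0 // !divn_small ?addn0.
have xy := leg_inj d_neq legs; move: arrow_eq.
rewrite -xy => /addnI/IH -> //; exact: turn_neq.
Qed.

Lemma arrow_rcons d s x :
  arrow d (rcons s x) = 3 * arrow d s + leg (foldl turn d s) x.
Proof.
elim: s d => [|y s IH] d /=; first by rewrite expn0 muln1 addn0.
by rewrite IH size_rcons expnS mulnDr addnA mulnCA.
Qed.

Lemma foldl_turn_neq d s :
  d.1 != d.2 -> (foldl turn d s).1 != (foldl turn d s).2.
Proof. by elim: s d => //= x s IH d /(turn_neq x)/IH. Qed.

(** In each triangle the curve skips the corner of colour [third d.1 d.2]; the
other two are its entry (leg 0) and its exit (leg 2). *)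
Lemma leg_color d s x : d.1 != d.2 ->
  (leg (foldl turn d s) x == 1) = (color (rcons s x) == third d.1 d.2).
Proof.
rewrite color_rcons; elim: s d => [|y s IH] d d_neq /=; first exact: leg_third.
rewrite IH ?turn_neq // third_turn //.
by rewrite -(inj_eq (can_inj (thirdK y))) thirdK.
Qed.

(** The number of a vertex along the curve. The corners of the triangle at
position q have arrow 3q (entry), 3q + 1 (avoided) and 3q + 2 (exit); the exit
of triangle q is the entry 3(q + 1) of the next one, and both are sent to
q + 1. *)
Definition stop (d : 'I_3 * 'I_3) (w : seq 'I_3) : nat := (arrow d w).+1 %/ 3.

Lemma stop_cons d x w : 0 < size w ->
  stop d (x :: w) = leg d x * 3 ^ (size w).-1 + stop (turn d x) w.
Proof.
case: w => // y w _; rewrite /stop [arrow]lock /= -lock.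
by rewrite -addnS expnSr mulnA divnMDl.
Qed.

Lemma arrow_start d l : d.1 != d.2 -> arrow d (nseq l d.1) = 0.
Proof.
elim: l d => //= l IH d d_neq; rewrite /leg eqxx (negPf d_neq) /=.
by have := IH _ (turn_neq d.1 d_neq); rewrite /= (negPf d_neq).
Qed.

Lemma arrow_end d l : d.1 != d.2 -> (arrow d (nseq l d.2)).+1 = 3 ^ l.
Proof.
elim: l d => //= l IH d d_neq; rewrite /leg eqxx eq_sym (negPf d_neq) /=.
have := IH _ (turn_neq d.2 d_neq); rewrite /= eq_sym (negPf d_neq) size_nseq.
by rewrite expnS; lia.
Qed.

(** Up to symmetry, j is the letter c of the middle copy. Then i is a or b, and
the two words are the end of the curve in one copy and its start in the
next. *)
Lemma stop_switch d i j l :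
  d.1 != d.2 -> i != j -> third i j != third d.1 d.2 ->
  stop d (i :: nseq l.+1 j) = stop d (j :: nseq l.+1 i).
Proof.
move=> d_neq; set c := third d.1 d.2.
have [c1 c2] : (c == d.1) = false /\ (c == d.2) = false.
  by rewrite /c; case: d d_neq {c} => [] [[|[|[|i']]] ?] [[|[|[|j']]] ?].
have turn_c : turn d c = d by rewrite /turn c1 c2; case: (d).
have leg_c : leg d c = 1 by rewrite /leg c1 c2.
wlog -> : i j / j = c => [switch ij ij_c|].
  have [jc | jc] := eqVneq j c; first exact: switch.
  have [ic | ic] := eqVneq i c.
    by apply/esym/switch; rewrite // 1?eq_sym // eq_sym thirdC.
  (* Otherwise i and j are d.1 and d.2, in some order, and c completes them. *)
  case/negP: ij_c; move: d_neq ij ic jc; rewrite /c.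
  by case: d {c c1 c2 turn_c leg_c switch} i j =>
    [] [[|[|[|?]]] ?] [[|[|[|?]]] ?] [[|[|[|?]]] ?] [[|[|[|?]]] ?].
move=> ic ij_c; have /orP[] : (i == d.1) || (i == d.2).
- move: d_neq ic; rewrite /c.
  by case: d {c c1 c2 turn_c leg_c ij_c} i =>
    [] [[|[|[|?]]] ?] [[|[|[|?]]] ?] [[|[|[|?]]] ?].
- move=> /eqP i1; rewrite i1 in ic *.
  have leg_i : leg d d.1 = 0 by rewrite /leg eqxx (negPf d_neq).
  have turn_i : turn d d.1 = (d.1, c) by rewrite /turn eqxx (negPf d_neq).
  have arrow_c := @arrow_end (d.1, c) l.+1 ic.
  rewrite /stop [nseq]lock /= -lock turn_i turn_c leg_i leg_c arrow_start //.
  by rewrite !size_nseq mul0n add0n mul1n addn0 arrow_c expnS; lia.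
- move=> /eqP i2; rewrite i2 eq_sym in ic *.
  have leg_i : leg d d.2 = 2 by rewrite /leg eqxx eq_sym d_neq.
  have turn_i : turn d d.2 = (c, d.2) by rewrite /turn eqxx eq_sym (negPf d_neq).
  have arrow_c := @arrow_start (c, d.2) l.+1 ic.
  have arrow_d := arrow_end l.+1 d_neq.
  rewrite /stop [nseq]lock /= -lock turn_i turn_c leg_i leg_c arrow_c.
  by rewrite !size_nseq addn0 mul1n -addnS arrow_d expnS; lia.
Qed.

(** So [stop] is defined on the vertices that lie on the curve. *)
Lemma stop_mate d w : d.1 != d.2 -> color w != third d.1 d.2 ->
  stop d (mate w) = stop d w.
Proof.
have [w_const | [s [i [j [l [ij ->]]]]]] := constant_or_switch w.
  by rewrite mate_constant.
rewrite mate_switch //; elim: s d => [|x s IH] d d_neq w_col.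
  apply/esym/stop_switch => //; move: w_col.
  by rewrite color_switch.
have [szi szj] : 0 < size (s ++ i :: nseq l.+1 j) /\
                 0 < size (s ++ j :: nseq l.+1 i).
  by rewrite !size_cat !addn_gt0 !orbT.
rewrite !cat_cons !stop_cons // !size_cat /= !size_nseq; congr (_ + _).
apply: IH; first exact: turn_neq.
move: w_col; rewrite cat_cons color_cons // third_turn //.
by apply: contra => /eqP->; rewrite thirdK.
Qed.

(** * Colour classes are minimum feedback vertex sets *)

Section Triangle.
Variable n : nat.
Local Notation word := (sierpinski 3 n.+1).
Local Notation triangle := (sierpinski_triangle 3 n).
Local Notation proj := (contract_class (@nonclique 3 n.+1)).
Implicit Types (u v : word) (B : {set triangle}).

Definition color_class k : {set triangle} :=
  [set proj u | u : word & color u == k].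

Lemma color_proj u v : proj u = proj v -> color u = color v.
Proof.
move/eqP; rewrite contract_class_eq => /orP[] /eqP-> //.
by rewrite /= color_mate.
Qed.

Lemma mem_color_class k u : (proj u \in color_class k) = (color u == k).
Proof.
apply/imsetP/idP=> [[v] | u_col]; last by exists u; rewrite ?inE.
by rewrite inE => /eqP <- /color_proj->.
Qed.

(** The vertices that remain are ranked along the arrowhead curve. An edge that
increases the rank goes from the entry to the exit of the triangle whose
position is the rank of its source; as positions determine triangles, there is
at most one such edge from a given vertex. *)
Lemma color_class_fvs k : feedback_vertex_set (color_class k).
Proof.
(* The two colours other than k, in one of the two possible orders. *)
pose d : 'I_3 * 'I_3 := (k + 1, k - 1)%R.
have d_neq : d.1 != d.2 by rewrite /d; case: k {d} => [[|[|[|?]]] ?].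
have d_k : third d.1 d.2 = k.
  by apply/eqP; rewrite /d; case: k {d d_neq} => [[|[|[|?]]] ?].
pose rank (x : triangle) :=
  if [pick u | x == proj u] is Some u then stop d u else 0.
have rankE u : proj u \notin color_class k -> rank (proj u) = stop d u.
  rewrite mem_color_class -d_k => u_col; rewrite /rank.
  case: pickP => [v | /(_ u)/eqP//]; rewrite contract_class_eq.
  by case/orP=> /eqP-> //=; rewrite stop_mate.
have rank_edge (s : n.-tuple 'I_3) i j : i != j ->
    proj (rcons_tuple s i) \notin color_class k ->
    proj (rcons_tuple s j) \notin color_class k ->
    rank (proj (rcons_tuple s i)) <= rank (proj (rcons_tuple s j)) ->
    [/\ rank (proj (rcons_tuple s i)) = arrow d s, leg (foldl turn d s) i = 0
      & leg (foldl turn d s) j = 2].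
  move=> ij iP jP; rewrite !rankE // /stop /= !arrow_rcons.
  move: iP jP; rewrite !mem_color_class -d_k -!leg_color //.
  have := leg_lt3 (foldl turn d s) i; have := leg_lt3 (foldl turn d s) j.
  have : leg (foldl turn d s) i != leg (foldl turn d s) j.
    by apply: contra ij => /eqP/leg_inj-> //; apply: foldl_turn_neq.
  move: (leg _ i) (leg _ j) (arrow d s) => a b q ab ltb lta a1 b1 le_ab.
  by split; lia.
apply: (@forest_of_rank (delete_vertices (color_class k))
          (fun x => rank (val x))).
move=> x y z xy xz /= rxy rxz; apply: val_inj.
have [s [i [j [ij xs ys]]]] := (adj_sierpinski_triangle _ _).1 xy.
have [t [i' [j' [ij' xt zt]]]] := (adj_sierpinski_triangle _ _).1 xz.
move: (valP x) (valP y) (valP z) => xP yP zP.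
move: rxy; rewrite xs ys => /rank_edge[] //; rewrite -?xs -?ys //.
move=> rank_s _ leg_j.
move: rxz; rewrite xt zt => /rank_edge[] //; rewrite -?xt -?zt //.
rewrite rank_s => /arrow_inj st _ leg_j'.
have {}st : s = t by apply/val_inj/st; rewrite // !size_tuple.
rewrite -st in leg_j' zt; rewrite ys zt.
by rewrite (leg_inj (foldl_turn_neq s d_neq) (etrans leg_j (esym leg_j'))).
Qed.

(** The colour of a corner is a bijective function of its last letter, so a
colour class has exactly one corner in each triangle. *)
Lemma card_color_class k :
  3 ^ n + #|color_class k :&: extreme_vertices 3 n| = #|color_class k|.*2.
Proof.
rewrite -card_preim_proj card_word_set; congr (_ + _).
rewrite -[3 in LHS]card_ord -card_tuple -sum1_card; apply: eq_bigr => s _.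
have [f fK Kf] := foldr_third_bij s.
apply: etrans (esym (cards1 (f k))) _; apply: eq_card => x.
rewrite !inE mem_color_class.
rewrite /= color_rcons; apply/eqP/eqP => [-> | <-]; first exact: Kf.
exact/esym/fK.
Qed.

Lemma color_class_extreme k : #|color_class k :&: extreme_vertices 3 n| = 1.
Proof.
apply: etrans (cards1 (hat n k)); apply: eq_card => x; rewrite !inE.
apply/andP/eqP => [[xk /imsetP[k' _ def_x]] | ->].
  move: xk; rewrite def_x mem_color_class /= => /eqP <-.
  by rewrite (color_constant k' n).
by split; [rewrite mem_color_class; apply/eqP/color_constant | exact: imset_f].
Qed.

(** The elementary triangles are cycles, so the set has a corner in each. *)
Lemma fvs_lower_bound B : feedback_vertex_set B ->
  3 ^ n + #|B :&: extreme_vertices 3 n| <= #|B|.*2.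
Proof.
move=> /forestP B_fvs; rewrite -card_preim_proj card_word_set leq_add2r.
rewrite -[3 in X in X <= _]card_ord -card_tuple -sum1_card.
apply: leq_sum => s _.
rewrite card_gt0; apply/set0Pn.
have [i iP | no_hit] := pickP (fun i => proj (rcons_tuple s i) \in B).
  by exists i; rewrite inE.
pose corner i : delete_vertices B :=
  exist _ (proj (rcons_tuple s i)) (negbT (no_hit i)).
have corner_inj : injective corner.
  by move=> i j /(congr1 val); apply: clique_injective.
have corner_adj i j : i != j -> adj (corner i) (corner j).
  by move=> ij; apply/adj_sierpinski_triangle; exists s, i, j.
case: (B_fvs [seq corner i | i <- [:: 0; 1; -1]%R]) => //.
apply/andP; split; first by apply/and4P; split=> //; apply: corner_adj.
by rewrite map_inj_uniq.
Qed.

End Triangle.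

(** Parity closes the gap between 3^n / 2, which the lower bound gives for a set
without extreme vertices, and the size of a colour class. *)
Lemma feedback_vertex_number_triangle n :
  (feedback_vertex_number (sierpinski_triangle 3 n)).*2 = (3 ^ n).+1.
Proof.
have [[B B_fvs <-] min_fvs] := feedback_vertex_numberP (sierpinski_triangle 3 n).
have := fvs_lower_bound B_fvs; have := card_color_class n ord0.
have := min_fvs _ (color_class_fvs n ord0); rewrite color_class_extreme.
have odd_pow : odd (3 ^ n) by rewrite oddX orbT.
rewrite -(odd_double_half (3 ^ n)) odd_pow; lia.
Qed.

Lemma card_triangle n : #|sierpinski_triangle 3 n|.*2 = 3 * (3 ^ n).+1.
Proof.
have -> : #|sierpinski_triangle 3 n| = \sum_k #|color_class n k|.
  pose vertex_color x := odflt ord0 [pick k | x \in color_class n k].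
  rewrite -sum1_card (partition_big vertex_color predT) //=.
  apply: eq_bigr => k _; rewrite -sum1_card; apply: eq_bigl => x /=.
  have [u ->] := contract_class_onto x; rewrite mem_color_class.
  rewrite /vertex_color; case: pickP => [k' | /(_ (color u))];
    rewrite mem_color_class ?eqxx //.
  by move/eqP->.
rewrite -muln2 big_distrl /= (eq_bigr (fun=> (3 ^ n).+1)) => [|k _].
  by rewrite sum_nat_const card_ord.
by rewrite muln2 -card_color_class color_class_extreme addn1.
Qed.

Local Open Scope ring_scope.

Theorem theorem3p2 :
  [/\ forall (n : nat) (A : {set sierpinski_triangle 3 n}),
        minimum_fvs A -> (#|A :&: extreme_vertices 3 n| <= 1)%N,
      forall n : nat, exists2 A : {set sierpinski_triangle 3 n},
        minimum_fvs A & #|A :&: extreme_vertices 3 n| = 1%N,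
      forall n : nat, (1 <= n)%N ->
        (feedback_vertex_number (sierpinski_triangle 3 n))%:Z =
        3 * (feedback_vertex_number (sierpinski_triangle 3 n.-1))%:Z - 1
    & forall n : nat,
        (feedback_vertex_number (sierpinski_triangle 3 n))%:Q = (3 ^+ n + 1) / 2 /\
        (3 ^+ n + 1) / 2 = #|sierpinski_triangle 3 n|%:Q / 3].
Proof.
split=> [n A | n | [//|n] _ | n].
- case/andP=> /fvs_lower_bound A_fvs /eqP A_min; move: A_fvs.
  rewrite A_min feedback_vertex_number_triangle.
  by rewrite -[X in (_ <= X)%N]addn1 leq_add2l.
- exists (color_class n ord0); last exact: color_class_extreme.
  rewrite /minimum_fvs color_class_fvs -(inj_eq double_inj).
  rewrite feedback_vertex_number_triangle -card_color_class.
  by rewrite color_class_extreme addn1 eqxx.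
- have := feedback_vertex_number_triangle n.
  have := feedback_vertex_number_triangle n.+1.
  by rewrite expnS /=; lia.
have rat_double m : (m.*2%:Q = m%:Q * 2)%R by rewrite -muln2 PoszM intrM.
have tau2 := congr1 (fun m : nat => m%:Q) (feedback_vertex_number_triangle n).
have card2 := congr1 (fun m : nat => m%:Q) (card_triangle n).
have pow3 : (3 ^ n).+1%:Q = 3 ^+ n + 1 by rewrite -addn1 PoszD intrD -natrX.
rewrite /= !rat_double PoszM intrM pow3 in tau2 card2.
split; first by rewrite -tau2 mulfK.
apply: (mulIf (x := 2)) => //; rewrite divfK // mulrAC card2.
by rewrite mulrAC divff // mul1r.
Qed.
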